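(* Let $\Gamma, \Delta_1, \Delta_2$ be multisets of formulae, such that $\Delta_1$ does not contain any negated formula. Let $D$ be at most one formula. If the sequent $\Gamma^p, \lrcorner \Delta_1^n, \neg \Delta_2^n \vdash D^n$ is provable in the intuitionistic sequent calculus, then $\Gamma \vdash \Delta_1, \Delta_2, D$ is provable in the classical sequent calculus.
   Context: First-order logic with connectives $\wedge,\vee,\Rightarrow,\neg$ and quantifiers $\forall,\exists$. The classical sequent calculus is the usual cut-free multi-conclusion sequent calculus (sequents $\Gamma\vdash\Delta$ of multisets, axiom $\Gamma,A\vdash A,\Delta$, left/right rules for each connective and quantifier, contraction and weakening on both sides, no cut). The intuitionistic sequent calculus is its cut-free restriction where the right-hand side contains at most one formula. The antinegation operator $\lrcorner$ (not a connective) is defined by: $\lrcorner A = B$ if $A$ is $\neg B$, and $\lrcorner A=\neg A$ otherwise. The polarized Gödel–Gentzen translations are defined by induction: for $A$ atomic, $A^p\equiv A$ and $A^n\equiv\neg\neg A$; $(A\wedge B)^p\equiv A^p\wedge B^p$, $(A\wedge B)^n\equiv A^n\wedge B^n$; $(A\vee B)^p\equiv A^p\vee B^p$, $(A\vee B)^n\equiv\neg(\neg A^n\wedge\neg B^n)$; $(A\Rightarrow B)^p\equiv A^n\Rightarrow B^p$, $(A\Rightarrow B)^n\equiv A^p\Rightarrow B^n$; $(\neg A)^p\equiv\neg A^n$, $(\neg A)^n\equiv\neg A^p$; $(\forall x A)^p\equiv\forall x A^p$, $(\forall x A)^n\equiv\forall x A^n$; $(\exists x A)^p\equiv\exists x A^p$,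 $(\exists x A)^n\equiv\neg\forall x\neg A^n$. Translations, $\neg$ and $\lrcorner$ on multisets are applied formula by formula; if $D$ is empty, $D^n$ is empty. *)

(* Defs.v *)
From Stdlib Require Import List Permutation.
From Stdlib Require Vector.
Import ListNotations.

Set Implicit Arguments.
Unset Strict Implicit.
Unset Printing Implicit Defensive.

Record signature : Type := Signature {
  func : Type;
  func_arity : func -> nat;
  pred : Type;
  pred_arity : pred -> nat
}.

(* Bound variables are de Bruijn indices; an index is free when it is at
   least the number of enclosing quantifiers. *)
Inductive term (Sg : signature) : Type :=
| Var : nat -> term Sg
| App : forall f : func Sg, Vector.t (term Sg) (func_arity f) -> term Sg.

Arguments Var {Sg} _.
Arguments App {Sg} f _.

Inductive form (Sg : signature) : Type :=
| Atom : forall P : pred Sg, Vector.t (term Sg) (pred_arity P) -> form Sg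
| And : form Sg -> form Sg -> form Sg
| Or : form Sg -> form Sg -> form Sg
| Imp : form Sg -> form Sg -> form Sg
| Neg : form Sg -> form Sg
| All : form Sg -> form Sg
| Ex : form Sg -> form Sg.

Arguments Atom {Sg} P _.
Arguments And {Sg} _ _.
Arguments Or {Sg} _ _.
Arguments Imp {Sg} _ _.
Arguments Neg {Sg} _.
Arguments All {Sg} _.
Arguments Ex {Sg} _.

Fixpoint subst_term {Sg : signature} (s : nat -> term Sg) (t : term Sg) : term Sg :=
  match t with
  | Var n => s n
  | App f v => App f (Vector.map (subst_term s) v)
  end.

Definition up {Sg : signature} (s : nat -> term Sg) (n : nat) : term Sg :=
  match n with
  | 0 => Var 0
  | S m => subst_term (fun k => Var (S k)) (s m)
  end.

Fixpoint subst {Sg : signature} (s : nat -> term Sg) (A : form Sg) : form Sg :=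
  match A with
  | Atom P v => Atom P (Vector.map (subst_term s) v)
  | And A B => And (subst s A) (subst s B)
  | Or A B => Or (subst s A) (subst s B)
  | Imp A B => Imp (subst s A) (subst s B)
  | Neg A => Neg (subst s A)
  | All A => All (subst (up s) A)
  | Ex A => Ex (subst (up s) A)
  end.

Definition shift {Sg : signature} (A : form Sg) : form Sg :=
  subst (fun n => Var (S n)) A.

(* [inst t A] is A[t/x] for the variable x bound by the quantifier in front
   of the body A. *)
Definition inst {Sg : signature} (t : term Sg) (A : form Sg) : form Sg :=
  subst (fun n => match n with 0 => t | S m => Var m end) A.

Definition antineg {Sg : signature} (A : form Sg) : form Sg :=
  match A with
  | Neg B => B
  | _ => Neg A
  end.

Definition negated {Sg : signature} (A : form Sg) : Prop :=
  exists B : form Sg, A = Neg B.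

Fixpoint trp {Sg : signature} (A : form Sg) : form Sg :=
  match A with
  | Atom P v => Atom P v
  | And A B => And (trp A) (trp B)
  | Or A B => Or (trp A) (trp B)
  | Imp A B => Imp (trn A) (trp B)
  | Neg A => Neg (trn A)
  | All A => All (trp A)
  | Ex A => Ex (trp A)
  end
with trn {Sg : signature} (A : form Sg) : form Sg :=
  match A with
  | Atom P v => Neg (Neg (Atom P v))
  | And A B => And (trn A) (trn B)
  | Or A B => Neg (And (Neg (trn A)) (Neg (trn B)))
  | Imp A B => Imp (trp A) (trn B)
  | Neg A => Neg (trp A)
  | All A => All (trn A)
  | Ex A => Neg (All (Neg (trn A)))
  end.

(* Multisets are lists taken up to [Permutation], which the exchange rules make
   explicit; no other rule depends on the order beyond naming the principal
   formula first.  In the rules LK_AllR, LK_ExL, LJ_AllR and LJ_ExL the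
   eigenvariable is the index 0: shifting the side formulae makes it fresh. *)
Inductive LK {Sg : signature} : list (form Sg) -> list (form Sg) -> Prop :=
| LK_ax : forall G D A, LK (A :: G) (A :: D)
| LK_exch : forall G G' D D',
    Permutation G G' -> Permutation D D' -> LK G D -> LK G' D'
| LK_AndL : forall G D A B, LK (A :: B :: G) D -> LK (And A B :: G) D
| LK_AndR : forall G D A B,
    LK G (A :: D) -> LK G (B :: D) -> LK G (And A B :: D)
| LK_OrL : forall G D A B,
    LK (A :: G) D -> LK (B :: G) D -> LK (Or A B :: G) D
| LK_OrR : forall G D A B, LK G (A :: B :: D) -> LK G (Or A B :: D)
| LK_ImpL : forall G D A B,
    LK G (A :: D) -> LK (B :: G) D -> LK (Imp A B :: G) D
| LK_ImpR : forall G D A B, LK (A :: G) (B :: D) -> LK G (Imp A B :: D)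
| LK_NegL : forall G D A, LK G (A :: D) -> LK (Neg A :: G) D
| LK_NegR : forall G D A, LK (A :: G) D -> LK G (Neg A :: D)
| LK_AllL : forall G D A t, LK (inst t A :: G) D -> LK (All A :: G) D
| LK_AllR : forall G D A,
    LK (map shift G) (A :: map shift D) -> LK G (All A :: D)
| LK_ExL : forall G D A,
    LK (A :: map shift G) (map shift D) -> LK (Ex A :: G) D
| LK_ExR : forall G D A t, LK G (inst t A :: D) -> LK G (Ex A :: D)
| LK_weakL : forall G D A, LK G D -> LK (A :: G) D
| LK_weakR : forall G D A, LK G D -> LK G (A :: D)
| LK_contrL : forall G D A, LK (A :: A :: G) D -> LK (A :: G) D
| LK_contrR : forall G D A, LK G (A :: A :: D) -> LK G (A :: D).

(* The succedent, having at most one formula, is an [option]. *)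
Inductive LJ {Sg : signature} : list (form Sg) -> option (form Sg) -> Prop :=
| LJ_ax : forall G A, LJ (A :: G) (Some A)
| LJ_exch : forall G G' D, Permutation G G' -> LJ G D -> LJ G' D
| LJ_AndL : forall G D A B, LJ (A :: B :: G) D -> LJ (And A B :: G) D
| LJ_AndR : forall G A B,
    LJ G (Some A) -> LJ G (Some B) -> LJ G (Some (And A B))
| LJ_OrL : forall G D A B,
    LJ (A :: G) D -> LJ (B :: G) D -> LJ (Or A B :: G) D
| LJ_OrR1 : forall G A B, LJ G (Some A) -> LJ G (Some (Or A B))
| LJ_OrR2 : forall G A B, LJ G (Some B) -> LJ G (Some (Or A B))
| LJ_ImpL : forall G D A B,
    LJ G (Some A) -> LJ (B :: G) D -> LJ (Imp A B :: G) D
| LJ_ImpR : forall G A B, LJ (A :: G) (Some B) -> LJ G (Some (Imp A B))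
| LJ_NegL : forall G A, LJ G (Some A) -> LJ (Neg A :: G) None
| LJ_NegR : forall G A, LJ (A :: G) None -> LJ G (Some (Neg A))
| LJ_AllL : forall G D A t, LJ (inst t A :: G) D -> LJ (All A :: G) D
| LJ_AllR : forall G A, LJ (map shift G) (Some A) -> LJ G (Some (All A))
| LJ_ExL : forall G D A,
    LJ (A :: map shift G) (option_map shift D) -> LJ (Ex A :: G) D
| LJ_ExR : forall G A t, LJ G (Some (inst t A)) -> LJ G (Some (Ex A))
| LJ_weakL : forall G D A, LJ G D -> LJ (A :: G) D
| LJ_weakR : forall G A, LJ G None -> LJ G (Some A)
| LJ_contrL : forall G D A, LJ (A :: A :: G) D -> LJ (A :: G) D.

Definition list_of_option {T : Type} (o : option T) : list T :=
  match o with
  | Some x => [x]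
  | None => []
  end.

(* Main.v *)
Require Import Defs.
From Stdlib Require Import List Permutation Lia.
From Stdlib Require Vector.
Import ListNotations.

(** The proof is an induction on the intuitionistic derivation.  Every formula
    of an antecedent reached from the end-sequent encodes either a classical
    hypothesis or a classical conclusion ([enc]), and the succedent encodes at
    most one conclusion ([goal]); each intuitionistic rule then becomes at most
    one classical rule.  Axioms are the delicate case, since a formula
    may be at once a positive and a negative translation, as in
    [trp (Neg (Neg P)) = trn P] for [P] atomic. *)

Section Development.
Context {Sg : signature}.
Implicit Types (A B X Y : form Sg) (G D E : list (form Sg)).

(** * Substitution, and its commutation with the translations *)

Lemma subst_term_comp (s r u : nat -> term Sg) (t : term Sg) :
  (forall n, subst_term s (r n) = u n) ->
  subst_term s (subst_term r t) = subst_term u t.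
Proof.
  intros H. revert t. fix IH 1. intros [n | f v]; cbn.
  - apply H.
  - f_equal. induction v as [| a k v IHv]; cbn; f_equal; auto.
Qed.

Lemma subst_term_id (t : term Sg) : subst_term Var t = t.
Proof.
  revert t. fix IH 1. intros [n | f v]; cbn.
  - reflexivity.
  - f_equal. induction v as [| a k v IHv]; cbn; f_equal; auto.
Qed.

Lemma subst_term_cancel (s r : nat -> term Sg) (t : term Sg) :
  (forall n, subst_term s (r n) = Var n) -> subst_term s (subst_term r t) = t.
Proof.
  intros H. rewrite (subst_term_comp s r Var t H). apply subst_term_id.
Qed.

(** The hypothesis is pointwise, so passing under a binder needs no equality of substitutions as
    functions. *)
Lemma subst_cancel A (s r : nat -> term Sg) :
  (forall n, subst_term s (r n) = Var n) -> subst s (subst r A) = A.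
Proof.
  assert (Hup : forall s r : nat -> term Sg,
    (forall n, subst_term s (r n) = Var n) ->
    forall n, subst_term (up s) (up r n) = Var n).
  { clear. intros s r H [| n]; [reflexivity | cbn [up]].
    (* At a successor, [up s] after the shift agrees with the shift after [s]; both composites send
       [k] to [up s (S k)]. *)
    rewrite (subst_term_comp _ _ (fun k => up s (S k))) by reflexivity.
    cbn [up]. rewrite <- (subst_term_comp (fun k => Var (S k)) s) by reflexivity.
    now rewrite H. }
  revert s r. induction A; intros s r H; cbn; f_equal; auto.
  induction t as [| a k v IHv]; cbn; f_equal; auto.
  now apply subst_term_cancel.
Qed.

Lemma inst_Var0 A : inst (Var 0) (subst (up (fun n => Var (S n))) A) = A.
Proof. apply subst_cancel. now intros [| n]. Qed.

Lemma subst_tr A : forall s : nat -> term Sg,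
  subst s (trp A) = trp (subst s A) /\ subst s (trn A) = trn (subst s A).
Proof.
  induction A; intros s; cbn;
    repeat match goal with
    | H : forall s, _ /\ _ |- context [subst ?s'] =>
        destruct (H s'), (H (up s')); clear H
    end; split; congruence.
Qed.

Lemma subst_trp (s : nat -> term Sg) A : subst s (trp A) = trp (subst s A).
Proof. apply subst_tr. Qed.

Lemma subst_trn (s : nat -> term Sg) A : subst s (trn A) = trn (subst s A).
Proof. apply subst_tr. Qed.

(** * Derived rules of the classical calculus *)

Lemma LK_permR G D D' : Permutation D D' -> LK G D -> LK G D'.
Proof. intros H. now apply LK_exch. Qed.

Lemma LK_permL G G' D : Permutation G G' -> LK G D -> LK G' D.
Proof. intros H. now apply LK_exch. Qed.

(** Brings an encoded conclusion, which stands behind the goal [E], to the principal position and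
    back. *)
Lemma LK_middle G D E A : LK G (A :: D ++ E) <-> LK G (D ++ A :: E).
Proof.
  split; apply LK_permR; [| symmetry]; apply Permutation_middle.
Qed.

Lemma LK_weakL_app G G' D : LK G D -> LK (G ++ G') D.
Proof.
  intros H. apply LK_permL with (G' ++ G); [apply Permutation_app_comm |].
  induction G' as [| A G' IH]; cbn; auto using LK_weakL.
Qed.

Lemma LK_weakR_pre G D E : LK G D -> LK G (E ++ D).
Proof. intros H. induction E as [| A E IH]; cbn; auto using LK_weakR. Qed.

Lemma LK_weakR_app G D E : LK G D -> LK G (D ++ E).
Proof.
  intros H. apply LK_permR with (E ++ D); [apply Permutation_app_comm |].
  now apply LK_weakR_pre.
Qed.

Lemma LK_AllL_AllR A B : LK [A] [B] -> LK [All A] [All B].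
Proof.
  intros H. apply LK_AllR. cbn. apply LK_AllL with (Var 0).
  now rewrite inst_Var0.
Qed.

Lemma LK_AllR_ExR A B : LK [] [A; B] -> LK [] [All A; Ex B].
Proof.
  intros H. apply LK_AllR. cbn.
  apply LK_permR with [Ex (subst (up (fun n => Var (S n))) B); A];
    [apply perm_swap |].
  apply LK_ExR with (Var 0). rewrite inst_Var0.
  now apply LK_permR with (1 := perm_swap _ _ _).
Qed.

(** * Formulas that are translations in two ways *)

Fixpoint size A : nat :=
  match A with
  | Atom _ _ => 1
  | And A B | Or A B | Imp A B => S (size A + size B)
  | Neg A | All A | Ex A => S (size A)
  end.

(** The two claims call each other through negation: [trp (Neg A)] is [Neg (trn A)] and
    [trn (Neg A)] is [Neg (trp A)]. The roles of [A] and [B] are exchanged on the way, also to the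
    left of an implication, so the induction is on the sum of the sizes. *)
Lemma LK_tr_overlap (n : nat) : forall A B, size A + size B < n ->
  (trp A = trn B -> LK [A] [B]) /\ (trn A = Neg (trn B) -> LK [] [A; B]).
Proof.
  induction n as [| n IH]; [lia |]. intros A B Hn.
  assert (IHpn : forall A' B', size A' + size B' < size A + size B ->
            trp A' = trn B' -> LK [A'] [B'])
    by (intros A' B' H; apply IH; lia).
  assert (IHnn : forall A' B', size A' + size B' < size A + size B ->
            trn A' = Neg (trn B') -> LK [] [A'; B'])
    by (intros A' B' H; apply IH; lia).
  clear IH Hn. split; intros H.
  - destruct A as [P v | A1 A2 | A1 A2 | A1 A2 | A1 | A1 | A1].
    5: { apply LK_NegL. apply LK_permR with (1 := perm_swap _ _ _).
         apply IHnn; [cbn; lia | now symmetry]. }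
    (* Apart from negation, only conjunction, implication and universal quantification can head both
       a positive and a negative translation. *)
    all: destruct B as [Q w | B1 B2 | B1 B2 | B1 B2 | B1 | B1 | B1];
      cbn in H; try discriminate; injection H; intros; cbn in IHpn.
    + apply LK_AndL. apply LK_AndR.
      * apply (LK_weakL_app [A1] [A2]). apply IHpn; [lia | easy].
      * apply LK_weakL. apply IHpn; [lia | easy].
    + apply LK_ImpR. apply LK_permL with (1 := perm_swap _ _ _).
      apply LK_ImpL.
      * apply (LK_weakR_app [B1] [A1] [B2]). apply IHpn; [lia | easy].
      * apply (LK_weakL_app [A2] [B1]). apply IHpn; [lia | easy].
    + apply LK_AllL_AllR. apply IHpn; [lia | easy].
  - destruct A as [P v | A1 A2 | A1 A2 | A1 A2 | A1 | A1 | A1];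
      cbn in H; try discriminate; injection H as H.
    + destruct B as [Q w | | | | B1 | |]; cbn in H; try discriminate.
      injection H as H.
      destruct B1; cbn in H; try discriminate. rewrite <- H.
      apply LK_permR with (1 := perm_swap _ _ _).
      apply LK_NegR. apply LK_ax.
    (* Here [trn B] is a conjunction of negations, so [B] is a conjunction whose components each
       overlap with one disjunct. *)
    + destruct B as [| B1 B2 | | | | |]; cbn in H; try discriminate.
      injection H as H1 H2. cbn in IHnn.
      apply LK_permR with (1 := perm_swap _ _ _).
      apply LK_AndR; apply LK_permR with (1 := perm_swap _ _ _);
        apply LK_OrR.
      * apply (LK_permR [] (A1 :: [B1] ++ [A2])); [apply perm_skip, perm_swap |].
        apply (LK_weakR_app [] [A1; B1] [A2]).
        apply LK_permR with (1 := perm_swap _ _ _).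
        apply IHnn; [lia | easy].
      * apply LK_weakR. apply LK_permR with (1 := perm_swap _ _ _).
        apply IHnn; [lia | easy].
    + apply LK_NegR. apply IHpn; [cbn; lia | easy].
    + destruct B as [| | | | | B1 |]; cbn in H; try discriminate.
      injection H as H. cbn in IHnn.
      apply LK_permR with (1 := perm_swap _ _ _). apply LK_AllR_ExR.
      apply IHnn; [lia | easy].
Qed.

Lemma LK_trp_trn A B : trp A = trn B -> LK [A] [B].
Proof. eapply LK_tr_overlap, PeanoNat.Nat.lt_succ_diag_r. Qed.

Lemma LK_trn_Neg_trn A B : trn A = Neg (trn B) -> LK [] [A; B].
Proof. eapply LK_tr_overlap, PeanoNat.Nat.lt_succ_diag_r. Qed.

(** * Encodings and the simulation of derivations *)

(** [enc X s]: as an intuitionistic hypothesis, [X] stands for the classical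
    hypothesis [A] if [s = inl A], and for the classical conclusion [A] if
    [s = inr A].  The last three clauses are the unnegated [A] for
    which [antineg (trn A)] is not [Neg (trn A)]. *)
Inductive enc : form Sg -> form Sg + form Sg -> Prop :=
| enc_pos A : enc (trp A) (inl A)
| enc_neg A : enc (Neg (trn A)) (inr A)
| enc_atom P v : enc (Neg (Atom P v)) (inr (Atom P v))
| enc_or A B : enc (And (Neg (trn A)) (Neg (trn B))) (inr (Or A B))
| enc_ex A : enc (All (Neg (trn A))) (inr (Ex A)).

(** The bare atom arises from the left negation rule applied to
    [antineg (trn P)], which is [Neg P]. *)
Inductive goal : option (form Sg) -> list (form Sg) -> Prop :=
| goal_none : goal None []
| goal_trn A : goal (Some (trn A)) [A]
| goal_atom P v : goal (Some (Atom P v)) [Atom P v].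

(** For [A = Neg B], stripping the negation would leave [trp B], which [enc_pos] reads as a
    hypothesis. For atoms, disjunctions and existentials it yields exactly the last three clauses of
    [enc]; in the other cases a negation is added. *)
Lemma enc_antineg A : ~ negated A -> enc (antineg (trn A)) (inr A).
Proof.
  intros H. destruct A; try constructor; try exact (enc_neg _).
  now destruct H; eexists.
Qed.

Definition hyps (l : list (form Sg + form Sg)) : list (form Sg) :=
  flat_map (fun s => match s with inl A => [A] | inr _ => [] end) l.

Definition concls (l : list (form Sg + form Sg)) : list (form Sg) :=
  flat_map (fun s => match s with inl _ => [] | inr A => [A] end) l.

Definition shift_sum (s : form Sg + form Sg) : form Sg + form Sg :=
  match s with inl A => inl (shift A) | inr A => inr (shift A) end.

Lemma hyps_shift l : hyps (map shift_sum l) = map shift (hyps l).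
Proof.
  unfold hyps. induction l as [| [A | A] l IH]; cbn; congruence.
Qed.

Lemma concls_shift l : concls (map shift_sum l) = map shift (concls l).
Proof.
  unfold concls. induction l as [| [A | A] l IH]; cbn; congruence.
Qed.

Lemma enc_shift X s : enc X s -> enc (shift X) (shift_sum s).
Proof.
  unfold shift. intros []; cbn; rewrite ?subst_trp, ?subst_trn; constructor.
Qed.

Lemma Forall2_enc_shift G l :
  Forall2 enc G l -> Forall2 enc (map shift G) (map shift_sum l).
Proof. induction 1; cbn; auto using enc_shift. Qed.

Lemma goal_shift d E : goal d E -> goal (option_map shift d) (map shift E).
Proof.
  intros [| A | P v]; cbn; [| unfold shift at 1; rewrite subst_trn |];
    constructor.
Qed.

(** Against a goal [trn B], the clauses [enc_pos] and [enc_neg] are the two overlap lemmas; the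
    other three determine the head connective of [B]. *)
Lemma LK_of_LJ_ax X s E :
  enc X s -> goal (Some X) E -> LK (hyps [s]) (E ++ concls [s]).
Proof.
  intros Hs HE. inversion HE as [| B HB | P v HP]; subst E; clear HE; subst X.
  - inversion Hs as [A HA | A HA | P v HA | A1 A2 HA | A HA]; subst s; cbn.
    + now apply LK_trp_trn.
    + now apply LK_trn_Neg_trn.
    + destruct B as [| | | | B | |]; cbn in HA; try discriminate.
      injection HA as HA. destruct B; cbn in HA; try discriminate.
      rewrite <- HA. apply LK_NegR, LK_ax.
    + destruct B as [| B1 B2 | | | | |]; cbn in HA; try discriminate.
      injection HA as H1 H2.
      apply LK_AndR; apply LK_permR with (1 := perm_swap _ _ _), LK_OrR.
      * apply (LK_permR [] ([A1; B1] ++ [A2])); [apply perm_skip, perm_swap |].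
        apply LK_weakR_app. apply LK_permR with (1 := perm_swap _ _ _).
        now apply LK_trn_Neg_trn.
      * apply LK_weakR. apply LK_permR with (1 := perm_swap _ _ _).
        now apply LK_trn_Neg_trn.
    + destruct B as [| | | | | B |]; cbn in HA; try discriminate.
      injection HA as HA. apply LK_AllR_ExR. now apply LK_trn_Neg_trn.
  (* A bare atom is encoded only as a hypothesis, and only by itself. *)
  - inversion Hs as [A HA | | | |]; subst s. cbn.
    destruct A; cbn in HA; try discriminate. rewrite HA. apply LK_ax.
Qed.

(** The readings [l] and [E] are quantified after the derivation, because each premise is used with
    the reading its rule dictates. *)
Lemma LK_of_LJ G d : LJ G d ->
  forall l E, Forall2 enc G l -> goal d E -> LK (hyps l) (E ++ concls l).
Proof.
  induction 1 as
    [ G X | G G' d HG _ IH | G d X Y _ IH | G X Y _ IH1 _ IH2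
    | G d X Y _ IH1 _ IH2 | G X Y _ IH | G X Y _ IH
    | G d X Y _ IH1 _ IH2 | G X Y _ IH | G X _ IH | G X _ IH
    | G d X t _ IH | G X _ IH | G d X _ IH | G X t _ IH
    | G d X _ IH | G X _ IH | G d X _ IH ];
    intros l E Hl HE.
  - inversion Hl as [| ? s ? l' Hs Hl']; subst.
    assert (Hax := LK_of_LJ_ax _ _ _ Hs HE).
    apply LK_exch with (hyps [s] ++ hyps l') ((E ++ concls [s]) ++ concls l').
    + unfold hyps. now rewrite <- flat_map_app.
    + unfold concls. now rewrite <- app_assoc, <- flat_map_app.
    + now apply LK_weakL_app, LK_weakR_app.
  - destruct (Permutation_Forall2 (Permutation_sym HG) Hl) as (l' & Hp & Hl').
    apply LK_exch with (hyps l') (E ++ concls l'); auto.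
    + symmetry. now apply Permutation_flat_map.
    + apply Permutation_app_head. symmetry. now apply Permutation_flat_map.
  - inversion Hl as [| ? s ? l' Hs Hl']; subst.
    inversion Hs as [A HA | | | A B HA | ]; subst; cbn.
    + destruct A as [| A B | | | | |]; try discriminate.
      injection HA as <- <-. apply LK_AndL.
      apply (IH (inl A :: inl B :: l')); repeat constructor; auto.
    (* The conjunction of negations encodes a disjunctive conclusion, so the left rule becomes the
       right disjunction rule. *)
    + apply LK_middle, LK_OrR.
      apply LK_permR with (E ++ A :: B :: concls l').
      * rewrite <- Permutation_middle. now rewrite <- Permutation_middle.
      * apply (IH (inr A :: inr B :: l')); repeat constructor; auto.
  - inversion HE as [| C HC |]; subst.
    destruct C as [| A B | | | | |]; try discriminate. injection HC as <- <-.
    apply LK_AndR; [apply (IH1 l [A]) | apply (IH2 l [B])];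
      auto using goal_trn.
  - inversion Hl as [| ? s ? l' Hs Hl']; subst.
    inversion Hs as [A HA | | | |]; subst.
    destruct A as [| | A B | | | |]; try discriminate.
    injection HA as <- <-.
    apply LK_OrL; [apply (IH1 (inl A :: l')) | apply (IH2 (inl B :: l'))];
      repeat constructor; auto.
  (* No negative translation is a disjunction. *)
  - inversion HE as [| C HC |]; subst. now destruct C.
  - inversion HE as [| C HC |]; subst. now destruct C.
  - inversion Hl as [| ? s ? l' Hs Hl']; subst.
    inversion Hs as [A HA | | | |]; subst.
    destruct A as [| | | A B | | |]; try discriminate.
    injection HA as <- <-. apply LK_ImpL.
    + apply LK_middle, LK_weakR_pre. apply (IH1 l' [A]); auto using goal_trn.
    + apply (IH2 (inl B :: l')); repeat constructor; auto.
  - inversion HE as [| C HC |]; subst.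
    destruct C as [| | | A B | | |]; try discriminate. injection HC as <- <-.
    apply LK_ImpR.
    apply (IH (inl A :: l) [B]); repeat constructor; auto.
  - inversion HE; subst.
    inversion Hl as [| ? s ? l' Hs Hl']; subst.
    inversion Hs as [A HA | A HA | P v HA | |]; subst; cbn.
    + destruct A as [| | | | A | |]; try discriminate. injection HA as <-.
      apply LK_NegL. apply (IH l' [A]); auto using goal_trn.
    (* The classical sequent is unchanged: the conclusion only moves from the encoded hypotheses to
       the goal. *)
    + apply (IH l' [A]); auto using goal_trn.
    + apply (IH l' [Atom P v]); auto using goal_atom.
  - inversion HE as [| C HC |]; subst.
    destruct C as [P v | | A B | | A | | A]; try discriminate;
      injection HC as <-.
    (* Conversely, the conclusion returns to the encoded hypotheses without a classical rule; only a
       genuine negation needs one. *)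
    + apply (IH (inr (Atom P v) :: l) []); repeat constructor; auto.
    + apply (IH (inr (Or A B) :: l) []); repeat constructor; auto.
    + apply LK_NegR. apply (IH (inl A :: l) []); repeat constructor; auto.
    + apply (IH (inr (Ex A) :: l) []); repeat constructor; auto.
  - inversion Hl as [| ? s ? l' Hs Hl']; subst.
    inversion Hs as [A HA | | | | A HA]; subst; cbn.
    + destruct A as [| | | | | A |]; try discriminate. injection HA as <-.
      apply LK_AllL with t. apply (IH (inl (inst t A) :: l')); auto.
      constructor; auto. unfold inst. rewrite subst_trp. constructor.
    (* An instance of the encoded existential is again a negated [trn], that is, an encoded
       conclusion. *)
    + apply LK_middle, LK_ExR with t, LK_middle.
      apply (IH (inr (inst t A) :: l')); auto.
      constructor; auto. unfold inst. cbn. rewrite subst_trn. constructor.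
  - inversion HE as [| C HC |]; subst.
    destruct C as [| | | | | A |]; try discriminate. injection HC as <-.
    apply LK_AllR. rewrite <- hyps_shift, <- concls_shift.
    apply (IH _ [A]); auto using goal_trn, Forall2_enc_shift.
  - inversion Hl as [| ? s ? l' Hs Hl']; subst.
    inversion Hs as [A HA | | | |]; subst.
    destruct A as [| | | | | | A]; try discriminate. injection HA as <-.
    apply LK_ExL. cbn.
    rewrite map_app, <- hyps_shift, <- concls_shift.
    apply (IH (inl A :: map shift_sum l')); auto using goal_shift.
    constructor; auto using enc_pos, Forall2_enc_shift.
  - inversion HE as [| C HC |]; subst. now destruct C.
  - inversion Hl as [| ? [A | A] ? l' _ Hl']; subst.
    + now apply LK_weakL, (IH l').
    + now apply LK_middle, LK_weakR, (IH l').
  - apply LK_weakR_pre. apply (IH l []); auto using goal_none.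
  - inversion Hl as [| ? s ? l' Hs Hl']; subst.
    (* Both copies of the contracted formula receive the same reading [s]. *)
    assert (Hss : LK (hyps (s :: s :: l')) (E ++ concls (s :: s :: l')))
      by auto.
    destruct s as [A | A]; cbn in *.
    + now apply LK_contrL.
    + apply LK_middle, LK_contrR.
      apply LK_permR with (2 := Hss).
      rewrite <- Permutation_middle. now rewrite <- Permutation_middle.
Qed.

End Development.

Theorem theorem4 (Sg : signature) (Gamma Delta1 Delta2 : list (form Sg))
    (D : option (form Sg))
    (HDelta1 : forall A : form Sg, In A Delta1 -> ~ negated A) :
  LJ (map trp Gamma ++ map antineg (map trn Delta1) ++ map Neg (map trn Delta2))
     (option_map trn D) ->
  LK Gamma (Delta1 ++ Delta2 ++ list_of_option D).
Proof.
  assert (Hl : Forall2 enc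
    (map trp Gamma ++ map antineg (map trn Delta1) ++ map Neg (map trn Delta2))
    (map inl Gamma ++ map inr Delta1 ++ map inr Delta2)).
  { repeat apply Forall2_app.
    - induction Gamma; cbn; auto using enc_pos.
    - induction Delta1 as [| A l IH]; cbn; constructor.
      + apply enc_antineg, HDelta1. now left.
      + apply IH. intros B HB. apply HDelta1. now right.
    - induction Delta2; cbn; auto using enc_neg. }
  assert (HD : goal (option_map trn D) (list_of_option D))
    by (destruct D; constructor).
  assert (Hinl : forall l : list (form Sg),
    hyps (map inl l) = l /\ concls (map inl l) = [])
    by (unfold hyps, concls; induction l as [| A l [IH1 IH2]]; cbn;
        split; congruence).
  assert (Hinr : forall l : list (form Sg),
    hyps (map inr l) = [] /\ concls (map inr l) = l)
    by (unfold hyps, concls; induction l as [| A l [IH1 IH2]]; cbn;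
        split; congruence).
  intros H. assert (HLK := LK_of_LJ _ _ H _ _ Hl HD).
  unfold hyps, concls in *. rewrite !flat_map_app in HLK.
  rewrite !(proj1 (Hinl _)), !(proj2 (Hinl _)) in HLK.
  rewrite !(proj1 (Hinr _)), !(proj2 (Hinr _)) in HLK.
  cbn in HLK. rewrite app_nil_r in HLK.
  (* The goal stands first in [HLK] and last in the statement. *)
  apply LK_permR with (2 := HLK).
  rewrite (app_assoc Delta1). apply Permutation_app_comm.
Qed.
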